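(* Let $G_1,G_2$ be generators over $\Sigma_1,\Sigma_2$, let $G_k$ be a generator (coordinator) over $\Sigma_k\subseteq\Sigma:=\Sigma_1\cup\Sigma_2$, let $\Sigma_u\subseteq\Sigma$ be the set of uncontrollable events, and let $K\subseteq L(G_1\|G_2\|G_k)$ be a language. Then the following two definitions of conditional controllability of $K$ are equivalent. (A) (i) $P_k(K)$ is controllable with respect to $L(G_k)$ and $\Sigma_{k,u}$; (ii) $P_{1+k}(K)$ is controllable with respect to $L(G_1)\|\overline{P_k(K)}$ and $\Sigma_{1+k,u}$; (iii) $P_{2+k}(K)$ is controllable with respect to $L(G_2)\|\overline{P_k(K)}$ and $\Sigma_{2+k,u}$. (B) (i) $P_k(K)$ is controllable with respect to $L(G_k)$ and $\Sigma_{k,u}$; (ii) $P_{1+k}(K)$ is controllable with respect to $L(G_1)\|\overline{P_k(K)}\|P_k^{2+k}(L(G_2)\|\overline{P_k(K)})$ and $\Sigma_{1+k,u}$; (iii) $P_{2+k}(K)$ is controllable with respect to $L(G_2)\|\overline{P_k(K)}\|P_k^{1+k}(L(G_1)\|\overline{P_k(K)})$ and $\Sigma_{2+k,u}$.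
   Context: A generator $G=(Q,\Sigma,f,q_0,Q_m)$ is a deterministic finite automaton with partial transition function; $L(G)=\{s\in\Sigma^*\mid f(q_0,s)\text{ is defined}\}$. $\overline{M}$ is the prefix closure of a language $M$. Projections erase events outside the target event set: $P_k:\Sigma^*\to\Sigma_k^*$, $P_{i+k}:\Sigma^*\to(\Sigma_i\cup\Sigma_k)^*$, $P_k^{i+k}:(\Sigma_i\cup\Sigma_k)^*\to\Sigma_k^*$. The synchronous product of languages $L_i$ over $A_i$ is the set of words over $\bigcup_iA_i$ whose projection to $A_i^*$ is in $L_i$ for every $i$; $L(G_1\|G_2\|G_k)=L(G_1)\|L(G_2)\|L(G_k)$. $\Sigma_{k,u}=\Sigma_k\cap\Sigma_u$ and $\Sigma_{i+k,u}=(\Sigma_i\cup\Sigma_k)\cap\Sigma_u$. A language $M$ is controllable with respect to a prefix-closed language $L$ and a set $U$ of uncontrollable events if $\overline{M}U\cap L\subseteq\overline{M}$. *)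

(* Defs.v *)
(* Events live in an ambient finite type, alphabets are finite
   subsets of it, and languages are (arbitrary, not necessarily decidable)
   classical sets of words. *)
From Stdlib Require List.
From mathcomp Require Import all_boot.
From mathcomp Require Import boolp classical_sets.

Set Implicit Arguments.
Unset Strict Implicit.
Unset Printing Implicit Defensive.

Local Open Scope classical_set_scope.

Section Defs.
Variable E : finType.
Implicit Types (A B U : {set E}) (K L M : set (seq E)) (s w : seq E).

(* [gen_trans] is a partial function on [gen_state * A]. *)
Record generator A := Generator {
  gen_state : finType;
  gen_trans : gen_state -> E -> option gen_state;
  gen_transP : forall q e, gen_trans q e -> e \in A;
  gen_init : gen_state;
  gen_marked : {set gen_state}
}.

Definition gen_run A (G : generator A) (q : gen_state G) s
    : option (gen_state G) :=
  foldl (fun oq e => obind (@gen_trans A G ^~ e) oq) (Some q) s.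

Definition gen_lang A (G : generator A) : set (seq E) :=
  [set s | gen_run (gen_init G) s].

Definition prefix_closure M : set (seq E) :=
  [set s | exists2 w, M w & prefix s w].

(* As words over any alphabet are words over [E], the projections from
   different source alphabets onto [A] are restrictions of this one map. *)
Definition natproj A s : seq E := [seq e <- s | e \in A].

(* The synchronous product of a list of languages, each one paired with its
   alphabet. *)
Definition sync (Ls : seq ({set E} * set (seq E))) : set (seq E) :=
  [set w | {subset w <= \bigcup_(AL <- Ls) AL.1}%SET
           /\ List.Forall (fun AL => AL.2 (natproj AL.1 w)) Ls].

Definition par_trans A B (G : generator A) (H : generator B)
    (q : gen_state G * gen_state H) (e : E) :
    option (gen_state G * gen_state H) :=
  match e \in A, e \in B with
  | true, true =>
      obind (fun q1 => omap (pair q1) (gen_trans q.2 e)) (gen_trans q.1 e)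
  | true, false => omap (pair^~ q.2) (gen_trans q.1 e)
  | false, true => omap (pair q.1) (gen_trans q.2 e)
  | false, false => None
  end.

Fact par_transP A B (G : generator A) (H : generator B)
    (q : gen_state G * gen_state H) (e : E) :
  par_trans q e -> e \in A :|: B.
Proof. by rewrite /par_trans inE; case: (e \in A); case: (e \in B). Qed.

Definition par A B (G : generator A) (H : generator B) : generator (A :|: B) :=
  Generator (@par_transP A B G H) (gen_init G, gen_init H)
            (finset.setX (gen_marked G) (gen_marked H)).

Lemma gen_runE A (G : generator A) q s :
  gen_run q s = if s is e :: s' then obind (@gen_run A G ^~ s') (gen_trans q e)
                else Some q.
Proof.
case: s => [|e s] //; rewrite /gen_run /=.
by case: gen_trans => //=; elim: s.
Qed.

Lemma gen_run_par A B (G : generator A) (H : generator B) s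
    (q : gen_state (par G H)) :
  isSome (gen_run q s) =
  [&& all [in A :|: B] s, isSome (gen_run q.1 (natproj A s))
    & isSome (gen_run q.2 (natproj B s))].
Proof.
elim: s q => [|e s IH] [p q] //.
rewrite gen_runE /= {1}/par_trans inE /=.
case: (boolP (e \in A)) => eA; case: (boolP (e \in B)) => eB //=;
  rewrite ?(@gen_runE A G _ (e :: _)) ?(@gen_runE B H _ (e :: _)) /=.
- case: (gen_trans p e) => [p'|] /=; last by rewrite andbF.
  by case: (gen_trans q e) => [q'|] /=; rewrite ?IH ?andbF.
- by case: (gen_trans p e) => [p'|] /=; rewrite ?IH ?andbF.
- by case: (gen_trans q e) => [q'|] /=; rewrite ?IH ?andbF.
Qed.

Lemma natproj_id A B s : A \subset B -> natproj A (natproj B s) = natproj A s.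
Proof.
move=> /fintype.subsetP AB; rewrite /natproj -filter_predI; apply: eq_filter => e /=.
by apply: andb_idr => /AB.
Qed.

Lemma all_gen_lang A (G : generator A) s : gen_lang G s -> all [in A] s.
Proof.
rewrite /gen_lang /=; move: (gen_init G); elim: s => //= e s IH q.
rewrite gen_runE; case D: gen_trans => [q'|] //= /IH ->.
by rewrite (@gen_transP _ G q) ?D.
Qed.

Lemma gen_lang_par A B C (G : generator A) (H : generator B)
    (I : generator C) :
  gen_lang (par (par G H) I) =
  sync [:: (A, gen_lang G); (B, gen_lang H); (C, gen_lang I)].
Proof.
have parP D F (X : generator D) (Y : generator F) s : gen_lang (par X Y) s <->
    [/\ all [in D :|: F] s, gen_lang X (natproj D s) & gen_lang Y (natproj F s)].
  rewrite /gen_lang /= gen_run_par /=.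
  by split=> [/and3P|?]; [|apply/and3P].
apply/seteqP; split=> w.
- move=> /parP[wABC /parP[_]]; rewrite !natproj_id ?finset.subsetUl ?finset.subsetUr // => GA HB IC.
  split; last by repeat constructor.
  by rewrite !big_cons big_nil finset.setU0 finset.setUA /=; apply/allP.
- rewrite /sync /= !big_cons big_nil finset.setU0 finset.setUA /=.
  move=> [/allP wABC F].
  move: (List.Forall_inv F) (List.Forall_inv (List.Forall_inv_tail F))
    (List.Forall_inv (List.Forall_inv_tail (List.Forall_inv_tail F))) => /= GA HB IC.
  apply/parP; split=> //; apply/parP; rewrite !natproj_id ?finset.subsetUl ?finset.subsetUr //.
  by split=> //; apply/allP => e; rewrite mem_filter => /andP[].
Qed.

(* The concept is used for prefix-closed [L] only; every plant language it is
   instantiated with below is prefix-closed. *)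
Definition controllable M L U : Prop :=
  [set rcons s u | s in prefix_closure M & u in [set` U]] `&` L
    `<=` prefix_closure M.

End Defs.

Definition cond_controllable (E : finType) (A1 A2 Ak Au : {set E})
    (G1 : generator A1) (G2 : generator A2) (Gk : generator Ak)
    (K : set (seq E)) : Prop :=
  let PkK := natproj Ak @` K in
  [/\ controllable PkK (gen_lang Gk) (Ak :&: Au),
      controllable (natproj (A1 :|: Ak) @` K)
        (sync [:: (A1, gen_lang G1); (Ak, prefix_closure PkK)])
        ((A1 :|: Ak) :&: Au)
    & controllable (natproj (A2 :|: Ak) @` K)
        (sync [:: (A2, gen_lang G2); (Ak, prefix_closure PkK)])
        ((A2 :|: Ak) :&: Au)].

Definition cond_controllable_proj (E : finType) (A1 A2 Ak Au : {set E})
    (G1 : generator A1) (G2 : generator A2) (Gk : generator Ak)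
    (K : set (seq E)) : Prop :=
  let PkK := natproj Ak @` K in
  [/\ controllable PkK (gen_lang Gk) (Ak :&: Au),
      controllable (natproj (A1 :|: Ak) @` K)
        (sync [:: (A1, gen_lang G1); (Ak, prefix_closure PkK);
                  (Ak, natproj Ak @`
                         sync [:: (A2, gen_lang G2);
                                  (Ak, prefix_closure PkK)])])
        ((A1 :|: Ak) :&: Au)
    & controllable (natproj (A2 :|: Ak) @` K)
        (sync [:: (A2, gen_lang G2); (Ak, prefix_closure PkK);
                  (Ak, natproj Ak @`
                         sync [:: (A1, gen_lang G1);
                                  (Ak, prefix_closure PkK)])])
        ((A2 :|: Ak) :&: Au)].

(* Main.v *)
(* A word t of the closure of P_k(K) is P_k(w) for a prefix w of a word of K;
   then P_{i+k}(w) lies in L(G_i) || closure(P_k(K)) and projects to t.  Hence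
   closure(P_k(K)) is contained in the extra component that (B) adds to the
   plant, so the plant languages of (A) and (B) coincide. *)
Require Import Defs.
From mathcomp Require Import all_boot.
From mathcomp Require Import boolp classical_sets.

Section Languages.
Local Open Scope classical_set_scope.
Variable E : finType.
Implicit Types (A B C : {set E}) (K L M N : set (seq E)) (s t w : seq E).

Lemma gen_lang_prefix A (G : generator A) s w :
  prefix s w -> gen_lang G w -> gen_lang G s.
Proof.
move=> /prefixP[v ->]; rewrite /gen_lang /= /gen_run foldl_cat.
(* A run that has reached [None] after [s] stays at [None] along [v]. *)
by case: (foldl _ _ s) => //; elim: v.
Qed.

Lemma natproj_prefix A s w : prefix s w -> prefix (natproj A s) (natproj A w).
Proof. by move=> /prefixP[v ->]; rewrite /natproj filter_cat prefix_prefix. Qed.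

(** Reading [w] from the left, [s] takes every event, erased or not, until [t] is used up. *)
Lemma prefix_natproj_lift A t w :
  prefix t (natproj A w) -> exists2 s, prefix s w & natproj A s = t.
Proof.
elim: w t => [|e w IH] [|a t] //; try by exists [::].
rewrite /natproj /=; case: ifP => eA.
  rewrite prefix_cons => /andP[/eqP -> /IH[s sw <-]].
  by exists (e :: s); rewrite ?prefix_cons ?eqxx //= /natproj /= eA.
by move=> /IH[s sw <-]; exists (e :: s); rewrite ?prefix_cons ?eqxx //= /natproj /= eA.
Qed.

Lemma prefix_closure_sub_natproj_sync A C (G : generator A) K :
  (forall w, K w -> gen_lang G (natproj A w)) ->
  prefix_closure (natproj C @` K) `<=`
  natproj C @` sync [:: (A, gen_lang G); (C, prefix_closure (natproj C @` K))].
Proof.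
move=> KG t [_ [w Kw <-] tw].
have [s sw st] := @prefix_natproj_lift C t w tw.
have Cs : natproj C (natproj (A :|: C) s) = t.
  by rewrite natproj_id ?finset.subsetUr.
(* The prefix [s] itself may contain events outside [A :|: C], which no word of the product has;
   erasing them changes neither projection. *)
exists (natproj (A :|: C) s) => //; split.
  rewrite !big_cons big_nil finset.setU0 => e.
  by rewrite mem_filter => /andP[].
constructor => /=.
  rewrite natproj_id ?finset.subsetUl //.
  exact: gen_lang_prefix (@natproj_prefix A _ _ sw) (KG w Kw).
by constructor => //=; rewrite Cs; exists (natproj C w) => //; exists w.
Qed.

(** Both [M] and [N] constrain the same projection to [C], so together they act as their
    intersection, which is [M]. *)
Lemma sync_superset A C L M N : M `<=` N ->
  sync [:: (A, L); (C, M); (C, N)] = sync [:: (A, L); (C, M)].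
Proof.
move=> MN; rewrite /sync !big_cons !big_nil /= !finset.setU0 finset.setUid.
apply/seteqP; split=> w [wAC /List.Forall_cons_iff[Lw /List.Forall_cons_iff[Mw _]]];
  split=> //; repeat constructor => //.
exact: MN.
Qed.

End Languages.

Theorem lemma2 (E : finType) (A1 A2 Ak Au : {set E})
    (G1 : generator A1) (G2 : generator A2) (Gk : generator Ak)
    (hAk : Ak \subset A1 :|: A2) (hAu : Au \subset A1 :|: A2)
    (K : set (seq E))
    (hK : (K `<=` gen_lang (par (par G1 G2) Gk))%classic) :
  cond_controllable Au G1 G2 Gk K <-> cond_controllable_proj Au G1 G2 Gk K.
Proof.
move: hK; rewrite gen_lang_par => hK.
have K1 w : K w -> gen_lang G1 (natproj A1 w).
  by move=> /hK[_ /List.Forall_cons_iff[]].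
have K2 w : K w -> gen_lang G2 (natproj A2 w).
  by move=> /hK[_ /List.Forall_cons_iff[_ /List.Forall_cons_iff[]]].
(* Each plant of (B) reduces to that of (A); the inclusion needed is the one for [G2] in (ii) and
   for [G1] in (iii). *)
by rewrite /cond_controllable_proj !sync_superset //;
  apply: prefix_closure_sub_natproj_sync.
Qed.
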